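(* Let $n>2$ be an integer. Then: (i) there exist positive integers $x,y,z$ with $n=x+y+z$ such that $x+11y+13z$ is a perfect square; (ii) there exist positive integers $x,y,z$ with $n=x+y+z$ such that $x+240y+720z$ is a perfect square.
   Context: A perfect square means the square of an integer. *)

(* Defs.v *)
From Stdlib Require Import ZArith.

Definition perfect_square (a : Z) : Prop := exists m : Z, a = (m ^ 2)%Z.

(* Main.v *)
Require Import Defs.
From Stdlib Require Import ZArith.
From Stdlib Require Import Lia List Bool.
Open Scope Z_scope.

Ltac Zify.zify_post_hook ::= Z.to_euclidean_division_equations.

(** Eliminating [x = n - y - z], the two parts ask for a square [m ^ 2] whose
    excess [t = m ^ 2 - n] is [10 y + 12 z], respectively [239 y + 719 z], with
    [y, z >= 1] and [y + z < n].  In terms of [s = y + z] the excess is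
    [a s + d z] with [0 < z < s < n], where [(a, d)] is [(10, 2)] or
    [(239, 480)].  For fixed [s] these values form an arithmetic progression of
    step [d] from [a s + d] to [(a + d) s - d].  As [s] grows, the ranges for
    successive [s] overlap more and more, so every large [t] at most about
    [a n] is attained, subject only to a congruence:
    - for step 2, [t] has to be even, so [m] must have the parity of [n];
    - for step 480, [239] is its own inverse modulo [480], so [s] has to be
      congruent to [239 t], and a window of 480 admissible values of [s]
      always contains a suitable one.

    It remains to find a square between [n] plus a constant and [(a + 1) n],
    which the integer square root of [(a + 1) n] provides once [n] is moderately
    large ([n >= 11] and [n >= 730]).  The smaller [n] are finitely many:
    explicit solutions settle part (i), and a computation settles part (ii),
    by trying for each [n] the squares of [31, ..., 141]. *)

(** The largest [s] with [5 s < k] leaves [z = k - 5 s <= 5], which is below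
    [s] because [31 <= k] forces [6 <= s]. *)
Lemma five_six_combination (n k : Z) :
  31 <= k <= 5 * n ->
  exists y z, y > 0 /\ z > 0 /\ y + z < n /\ 5 * y + 6 * z = k.
Proof.
  intros Hk.
  pose (s := (k - 1) / 5).
  assert (Hs : 5 * s <= k - 1 < 5 * s + 5) by (unfold s; lia).
  exists (s - (k - 5 * s)), (k - 5 * s).
  lia.
Qed.

(** Of the two largest integers with square at most [11 n], one has the parity
    of [n], and it is less than 2 below the square root of [11 n]. *)
Lemma square_same_parity (n : Z) :
  11 <= n -> exists m k, m ^ 2 = n + 2 * k /\ 31 <= k <= 5 * n.
Proof.
  intros Hn.
  pose (r := Z.sqrt (11 * n)).
  assert (Hr : r * r <= 11 * n < (r + 1) * (r + 1)).
  { pose proof (Z.sqrt_spec (11 * n) ltac:(lia)) as H.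
    fold r in H; unfold Z.succ in H. exact H. }
  assert (Hr0 : 0 <= r) by apply Z.sqrt_nonneg.
  assert (H11 : 11 <= r) by nia.
  assert (Hm : exists m, m mod 2 = n mod 2 /\ 0 <= m /\
                 m * m <= 11 * n < (m + 2) * (m + 2)).
  { destruct (Z.eq_dec (r mod 2) (n mod 2)) as [E | E].
    - exists r. repeat split; try nia.
    - exists (r - 1). split; [lia |].
      split; [lia |]. nia. }
  destruct Hm as [m (Hpar & Hm0 & Hm)].
  assert (Hmn : m <= n) by nia.
  assert (Hev : (m * m - n) mod 2 = 0).
  { rewrite Zminus_mod, Zmult_mod, Hpar, <- Zmult_mod, <- Zminus_mod.
    replace (n * n - n) with (n * (n - 1)) by ring.
    destruct (Z.Even_or_Odd n) as [[j ->] | [j ->]].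
    - replace (2 * j * (2 * j - 1)) with (j * (2 * j - 1) * 2) by ring.
      apply Z_mod_mult.
    - replace ((2 * j + 1) * (2 * j + 1 - 1)) with ((2 * j + 1) * j * 2) by ring.
      apply Z_mod_mult. }
  exists m, ((m * m - n) / 2).
  rewrite Z.pow_2_r. lia.
Qed.

Lemma square_of_weights_1_11_13 (n : Z) :
  n > 2 ->
  exists x y z : Z, x > 0 /\ y > 0 /\ z > 0 /\ n = x + y + z /\
    perfect_square (x + 11 * y + 13 * z).
Proof.
  intros Hn.
  assert (red : forall y z m, y > 0 -> z > 0 -> y + z < n ->
            n + 10 * y + 12 * z = m ^ 2 ->
            exists x y z : Z, x > 0 /\ y > 0 /\ z > 0 /\ n = x + y + z /\
              perfect_square (x + 11 * y + 13 * z)).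
  { intros y z m Hy Hz Hyz E.
    exists (n - y - z), y, z. repeat split; try lia.
    exists m. lia. }
  destruct (Z_lt_le_dec n 11) as [Hsmall | Hbig].
  - assert (H : n = 3 \/ n = 4 \/ n = 5 \/ n = 6 \/ n = 7 \/ n = 8 \/ n = 9 \/
                n = 10) by lia.
    destruct H as [E|[E|[E|[E|[E|[E|[E|E]]]]]]]; subst n.
    + apply (red 1 1 5); lia.
    + apply (red 2 1 6); lia.
    + apply (red 2 2 7); lia.
    + apply (red 1 4 8); lia.
    + apply (red 3 1 7); lia.
    + apply (red 2 3 8); lia.
    + apply (red 6 1 9); lia.
    + apply (red 3 2 8); lia.
  - destruct (square_same_parity n Hbig) as [m [k [Em Hk]]].
    destruct (five_six_combination n k Hk) as [y [z (Hy & Hz & Hyz & E)]].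
    apply (red y z m); lia.
Qed.

(** The two bounds on [t] say exactly that [z = (t - 239 s) / 480] satisfies
    [1 <= z <= s - 1]. *)
Lemma square_of_excess (n m s : Z) (t := m * m - n) :
  (t - 239 * s) mod 480 = 0 ->
  239 * s + 480 <= t -> t + 480 <= 719 * s -> s < n ->
  exists x y z : Z, x > 0 /\ y > 0 /\ z > 0 /\ n = x + y + z /\
    perfect_square (x + 240 * y + 720 * z).
Proof.
  intros Hmod Hlo Hhi Hs.
  pose (z := (t - 239 * s) / 480).
  assert (Hz : t = 239 * s + 480 * z) by (unfold z; lia).
  exists (n - s), (s - z), z. repeat split; try lia.
  exists m. rewrite Z.pow_2_r. unfold t in Hz. lia.
Qed.

(** This is the congruence [239 * 239 = 1] modulo [480]. *)
Lemma residue_239 (t q : Z) : (t - 239 * (239 * t - 480 * q)) mod 480 = 0.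
Proof.
  replace (t - 239 * (239 * t - 480 * q)) with ((239 * q - 119 * t) * 480) by ring.
  apply Z_mod_mult.
Qed.

(** Among the 480 values of [s] ending at the largest one with
    [239 s + 480 <= t], one is congruent to [239 t]; even the smallest of
    them satisfies [t + 480 <= 719 s] when [t] is this large. *)
Lemma large_excess (n t : Z) :
  173010 <= t <= 239 * n ->
  exists s, (t - 239 * s) mod 480 = 0 /\
    239 * s + 480 <= t /\ t + 480 <= 719 * s /\ s < n.
Proof.
  intros Ht.
  pose (u := (t - 480) / 239).
  assert (Hu : 239 * u <= t - 480 < 239 * u + 239) by (unfold u; lia).
  pose (q := - ((u - 239 * t) / 480)).
  exists (239 * t - 480 * q).
  split; [apply residue_239 |].
  assert (Hs : u - 480 < 239 * t - 480 * q <= u) by (unfold q; lia).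
  lia.
Qed.

(** Only the least nonnegative [s] congruent to [239 t] is tried, so that a
    single test decides each pair [(n, m)] instead of a search over [s]. *)
Definition small_solution (n m : Z) : bool :=
  let t := m * m - n in
  let s := (239 * t) mod 480 in
  (239 * s + 480 <=? t) && (t + 480 <=? 719 * s) && (s <? n).

Lemma small_solutions :
  forallb (fun i =>
      existsb (fun j => small_solution (Z.of_nat i) (Z.of_nat j)) (seq 31 111))
    (seq 3 727) = true.
Proof. vm_compute. reflexivity. Qed.

Lemma square_of_weights_1_240_720 (n : Z) :
  n > 2 ->
  exists x y z : Z, x > 0 /\ y > 0 /\ z > 0 /\ n = x + y + z /\
    perfect_square (x + 240 * y + 720 * z).
Proof.
  intros Hn.
  destruct (Z_lt_le_dec n 730) as [Hsmall | Hbig].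
  - assert (Hin : In (Z.to_nat n) (seq 3 727)) by (apply in_seq; lia).
    pose proof (proj1 (forallb_forall _ _) small_solutions _ Hin) as H.
    apply existsb_exists in H. destruct H as [j [_ H]].
    rewrite Z2Nat.id in H by lia.
    unfold small_solution in H.
    rewrite !andb_true_iff, !Z.leb_le, Z.ltb_lt in H.
    destruct H as [[Hlo Hhi] Hs].
    refine (square_of_excess n (Z.of_nat j) _ _ Hlo Hhi Hs).
    rewrite (Zmod_eq_full (239 * _)) by lia.
    rewrite (Z.mul_comm (_ / 480)).
    apply residue_239.
  - pose (m := Z.sqrt (240 * n)).
    assert (Hm : m * m <= 240 * n < (m + 1) * (m + 1)).
    { pose proof (Z.sqrt_spec (240 * n) ltac:(lia)) as H.
      fold m in H; unfold Z.succ in H. exact H. }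
    assert (Hm0 : 0 <= m) by apply Z.sqrt_nonneg.
    assert (Hmn : m <= n) by nia.
    (* The excess is at least 239 n - 2 m >= 237 n >= 237 * 730 = 173010. *)
    destruct (large_excess n (m * m - n)) as [s (Hmod & Hlo & Hhi & Hs)];
      [lia |].
    exact (square_of_excess n m s Hmod Hlo Hhi Hs).
Qed.

Theorem theorem1p1 : forall n : Z, n > 2 ->
  (exists x y z : Z, x > 0 /\ y > 0 /\ z > 0 /\ n = x + y + z /\
     perfect_square (x + 11 * y + 13 * z)) /\
  (exists x y z : Z, x > 0 /\ y > 0 /\ z > 0 /\ n = x + y + z /\
     perfect_square (x + 240 * y + 720 * z)).
Proof.
  intros n Hn. split.
  - exact (square_of_weights_1_11_13 n Hn).
  - exact (square_of_weights_1_240_720 n Hn).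
Qed.
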